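(* Let $d\ge 1$ and let $R>0$ be fixed. For every simple point process $P$ in $\mathbb{R}^d$, the image $\varphi_{\mathscr{D}_R}(P)$ of $P$ under the mapping $$\varphi_{\mathscr{D}_R}(\eta)=\sum_{X\subseteq\eta,\ (X,\eta)\in\mathscr{D}_R}\delta_X$$ is a random cluster tessellation in $\mathbb{R}^d$.
   Context: Point processes. $\mathscr{M}^{\bullet}(\mathbb{R}^d)$ is the set of locally finite simple counting measures on $\mathbb{R}^d$, identified with the locally finite subsets $\eta\subset\mathbb{R}^d$ (finitely many points in each bounded set, no multiple points), with the $\sigma$-algebra generated by the counting functions $\eta\mapsto \eta(B)$, $B\subset\mathbb{R}^d$ bounded Borel. A simple point process in $\mathbb{R}^d$ is a probability measure on $\mathscr{M}^{\bullet}(\mathbb{R}^d)$. Clusters. $\mathfrak{X}_d=\{X\subset\mathbb{R}^d : \operatorname{card}(X)<\infty\}$ is the space of clusters, with the $\sigma$-algebra generated, analogously, by the counting functions $X\mapsto\operatorname{card}(X\cap B)$. $\mathscr{M}^{\bullet}(\mathfrak{X}_d)$ is the set of locally finite cluster configurations, i.e. sets of clusters (written as sums of Dirac measures $\delta_X$) such that only finitely many of the clusters meet any given bounded subset of $\mathbb{R}^d$; its $\sigma$-algebra is generated by the counting functions. A probability measure on $\mathscr{M}^{\bullet}(\mathfrak{X}_d)$ is a cluster process. A cluster property is a measurable subset $\mathscr{D}\subset\mathfrak{X}_d\times\mathscr{M}^{\bullet}(\mathbb{R}^d)$; $X$ is a cluster of type $\mathscr{D}$ in $\eta$ if $(X,\eta)\in\mathscr{D}$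 and $X\subseteq\eta$. Tessellations. $\langle X\rangle$ denotes the convex hull of $X$. A cluster $X$ is a discrete polytope if for every $a\in X$ there is a supporting hyperplane $H$ of $\langle X\rangle$ with $H\cap\langle X\rangle=\{a\}$ (equivalently, $X$ is the vertex set of the convex polytope $\langle X\rangle$). It is a discrete simplex if it is the vertex set of a simplex. A collection $\mu\in\mathscr{M}^{\bullet}(\mathfrak{X}_d)$ of discrete polytopes is a cluster tessellation if the convex hulls of its clusters form a locally finite face-to-face tiling, where face-to-face means only that whenever two tiles intersect, they intersect in whole faces (a common face of both); the tiles need not cover $\mathbb{R}^d$ (holes are allowed, and the collection may be empty). A random cluster tessellation is a cluster process concentrated on the set of cluster tessellations. The property $\mathscr{D}_R$. For a $d$-dimensional discrete simplex $X$ ($d+1$ affinely independent points), $K(X)$ is its circumball, i.e. the unique closed ball whose boundary sphere contains $X$, and $\dot K(X)=K(X)\setminus X$. A pair $(X,\eta)\in\mathfrak{X}_d\times\mathscr{M}^{\bullet}(\mathbb{R}^d)$ belongs to $\mathscr{D}_R$ if: (i) $X$ is a $d$-dimensional discrete simplex; (ii) $\dot K(X)\cap\eta=\emptyset$; (iii) $K(X)$ has radius $\le R$. *)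

(* Defs.v *)
From HB Require Import structures.
From mathcomp Require Import all_boot all_order all_algebra finmap.
From mathcomp Require Import ring lra.
From mathcomp Require Import all_classical all_reals all_analysis measurable_realfun.

Set Implicit Arguments.
Unset Strict Implicit.
Unset Printing Implicit Defensive.

Import Order.TTheory GRing.Theory Num.Theory.
Import numFieldNormedType.Exports.

Local Open Scope classical_set_scope.
Local Open Scope ring_scope.

(* The library norm on ['rV[R]_d] is the sup norm; it is used below only through
   [open] and [bounded_set], for which it agrees with the Euclidean one. *)

Section geometry.
Context {R : realType} {d : nat}.
Local Notation V := 'rV[R]_d.
Implicit Types (u v x y c : V) (C F H : set V).

Definition dot u v : R := \sum_i u ord0 i * v ord0 i.

Definition edist x y : R := Num.sqrt (dot (x - y) (x - y)).

Definition esphere c (r : R) : set V := [set x | edist x c = r].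

Definition cball c (r : R) : set V := [set x | edist x c <= r].

Definition conv_hull (A : set V) : set V :=
  smallest (fun C => convex_set (C : set (convex_lmodType V))) A.

Definition supporting_hyperplane C H :=
  exists u (b : R), [/\ u != 0, H = [set x | dot u x = b],
    C `<=` [set x | dot u x <= b] & C `&` H !=set0].

(* Nonempty faces, including the improper face [C]. *)
Definition face C F :=
  F = C \/ exists2 H, supporting_hyperplane C H & F = C `&` H.

(* As the tiles need not cover the space, no covering condition is imposed; the
   second condition does not involve the empty face. *)
Definition face_to_face_tiling (T : set (set V)) :=
  (forall B : set V, bounded_set B ->
     finite_set [set C | T C /\ C `&` B !=set0]) /\
  (forall C C', T C -> T C' -> C `&` C' !=set0 ->
     face C (C `&` C') /\ face C' (C `&` C')).

Definition affinely_independent n (x : 'I_n -> V) :=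
  forall a : 'I_n -> R, \sum_i a i = 0 -> \sum_i a i *: x i = 0 ->
    forall i, a i = 0.

End geometry.

Section spaces.
Variables (R : realType) (d : nat).
Local Notation V := 'rV[R]_d.

Definition bounded_borel : set (set V) :=
  [set B | <<s @open V >> B /\ bounded_set B].

Definition fcluster : Type := {fset V}.
HB.instance Definition _ := Choice.on fcluster.
HB.instance Definition _ := Pointed.on fcluster.

Definition cluster_set (X : fcluster) : set V := [set` (X : {fset V})].

Definition locally_finite (eta : set V) :=
  forall B : set V, bounded_set B -> finite_set (eta `&` B).

Record config : Type := Config {
  config_set : set V ;
  config_lf : locally_finite config_set }.

Definition locally_finite_clusters (mu : set fcluster) :=
  forall B : set V, bounded_set B ->
    finite_set [set X | mu X /\ cluster_set X `&` B !=set0].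

Record cconfig : Type := CConfig {
  cconfig_set : set fcluster ;
  cconfig_lf : locally_finite_clusters cconfig_set }.

Lemma locally_finite0 : locally_finite set0.
Proof. by move=> B _; rewrite set0I. Qed.

Lemma locally_finite_clusters0 : locally_finite_clusters set0.
Proof.
move=> B _; rewrite (_ : [set _ | _] = set0)//.
by apply/seteqP; split => // X [].
Qed.

HB.instance Definition _ := gen_eqMixin config.
HB.instance Definition _ := gen_choiceMixin config.
HB.instance Definition _ := isPointed.Build config (Config locally_finite0).

HB.instance Definition _ := gen_eqMixin cconfig.
HB.instance Definition _ := gen_choiceMixin cconfig.
HB.instance Definition _ :=
  isPointed.Build cconfig (CConfig locally_finite_clusters0).

End spaces.

Coercion cluster_set : fcluster >-> set.
Coercion config_set : config >-> set.
Coercion cconfig_set : cconfig >-> set.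

Section measurable_spaces.
Variables (R : realType) (d : nat).
Local Notation V := 'rV[R]_d.

Definition cluster_generators : set (set (fcluster R d)) :=
  \bigcup_(B in @bounded_borel R d) preimage_set_system setT
    (fun X : fcluster R d => counting (X `&` B) : \bar R) measurable.

HB.instance Definition _ := Measurable.copy (fcluster R d)
  (g_sigma_algebraType cluster_generators).

Definition config_generators : set (set (config R d)) :=
  \bigcup_(B in @bounded_borel R d) preimage_set_system setT
    (fun eta : config R d => counting (eta `&` B) : \bar R) measurable.

HB.instance Definition _ := Measurable.copy (config R d)
  (g_sigma_algebraType config_generators).

(* Counts over every measurable set of clusters, hence possibly infinite. *)
Definition cconfig_generators : set (set (cconfig R d)) :=
  \bigcup_(A in @measurable _ (fcluster R d)) preimage_set_system setT
    (fun mu : cconfig R d => counting (mu `&` A) : \bar R) measurable.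

HB.instance Definition _ := Measurable.copy (cconfig R d)
  (g_sigma_algebraType cconfig_generators).

End measurable_spaces.

Section tessellations.
Context {R : realType} {d : nat}.
Local Notation V := 'rV[R]_d.
Implicit Types X : fcluster R d.

Definition discrete_polytope X :=
  forall a : V, cluster_set X a -> exists2 H,
    supporting_hyperplane (conv_hull X) H & H `&` conv_hull X = [set a].

Definition cluster_tessellation (mu : cconfig R d) :=
  (forall X, cconfig_set mu X -> discrete_polytope X) /\
  face_to_face_tiling [set conv_hull (cluster_set X) | X in cconfig_set mu].

(* Concentration means that the complement is contained in a measurable null set;
   the set of tessellations itself need not be measurable. *)
Definition random_cluster_tessellation (Q : probability (cconfig R d) R) :=
  {ae Q, forall mu, cluster_tessellation mu}.

Definition full_simplex X :=
  exists2 x : 'I_d.+1 -> V, affinely_independent x & cluster_set X = range x.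

(* Center and radius; characterized on full simplices by [circumsphereP] and
   [circumsphere_unique], arbitrary otherwise. *)
Definition circumsphere X : V * R :=
  get [set cr : V * R | cluster_set X `<=` esphere cr.1 cr.2].

Definition circumcenter X : V := (circumsphere X).1.
Definition circumradius X : R := (circumsphere X).2.
Definition circumball X : set V := cball (circumcenter X) (circumradius X).

(* Simple counting measures are encoded by their sets of atoms: this set stands
   for the sum of the Dirac masses at its elements. *)
Definition clusters_of_type (D : set (fcluster R d * config R d))
    (eta : config R d) : set (fcluster R d) :=
  [set X | cluster_set X `<=` eta /\ D (X, eta)].

Definition DR (r : R) : set (fcluster R d * config R d) :=
  [set Xe : fcluster R d * config R d | [/\ full_simplex Xe.1,
    (circumball Xe.1 `\` Xe.1) `&` Xe.2 = set0 & circumradius Xe.1 <= r]].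

End tessellations.

Section circumball.
Context {R : realType} {d : nat}.
Local Notation V := 'rV[R]_d.

Let dotC (u v : V) : dot u v = dot v u.
Proof. by apply: eq_bigr => i _; rewrite mulrC. Qed.

Let dotDl (u v w : V) : dot (u + v) w = dot u w + dot v w.
Proof. by rewrite -big_split; apply: eq_bigr => i _; rewrite mxE mulrDl. Qed.

Let dotNl (u w : V) : dot (- u) w = - dot u w.
Proof. by rewrite -sumrN; apply: eq_bigr => i _; rewrite mxE mulNr. Qed.

Let dot_ge0 (u : V) : 0 <= dot u u.
Proof. by apply: sumr_ge0 => i _; rewrite -expr2 sqr_ge0. Qed.

Let dotB (u w : V) : dot (u - w) (u - w) = dot u u - 2 * dot u w + dot w w.
Proof.
rewrite dotDl dotNl dotC (dotC w) !dotDl !dotNl (dotC w u).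
by ring.
Qed.

Let edges (x : 'I_d.+1 -> V) : 'M[R]_d :=
  \matrix_(i < d) (x (lift ord0 i) - x ord0).

Let edges_unit x : affinely_independent x -> edges x \in unitmx.
Proof.
move=> ai; rewrite -row_free_unit -kermx_eq0; apply/rowV0P => u /sub_kermxP uA.
pose a (i : 'I_d.+1) : R :=
  if unlift ord0 i is Some j then u ord0 j else - \sum_j u ord0 j.
have a0 : a ord0 = - \sum_j u ord0 j by rewrite /a unlift_none.
have aS j : a (lift ord0 j) = u ord0 j by rewrite /a liftK.
have suma : \sum_i a i = 0.
  rewrite big_ord_recl a0 addrC; apply/eqP; rewrite subr_eq0; apply/eqP.
  by apply: eq_bigr => j _; rewrite aS.
have sumax : \sum_i a i *: x i = 0.
  rewrite big_ord_recl a0 scaleNr scaler_suml addrC -sumrB -[RHS]uA.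
  rewrite mulmx_sum_row; apply: eq_bigr => j _.
  by rewrite aS rowK scalerBr.
by apply/rowP => j; rewrite mxE -aS (ai a suma sumax).
Qed.

Let edgesE x (w : V) i : (edges x *m w^T) i ord0 =
  dot (x (lift ord0 i) - x ord0) w.
Proof.
rewrite mxE; apply: eq_bigr => j _.
by rewrite !mxE.
Qed.

Let esphere_edges (x : 'I_d.+1 -> V) (c : V) :
  (exists r, range x `<=` esphere c r) <->
  (edges x *m (c - x ord0)^T =
   \col_i (2^-1 * dot (x (lift ord0 i) - x ord0) (x (lift ord0 i) - x ord0))).
Proof.
have key i : dot (x (lift ord0 i) - c) (x (lift ord0 i) - c) =
    dot (x (lift ord0 i) - x ord0) (x (lift ord0 i) - x ord0)
    - 2 * dot (x (lift ord0 i) - x ord0) (c - x ord0)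
    + dot (x ord0 - c) (x ord0 - c).
  have -> : dot (x ord0 - c) (x ord0 - c) = dot (c - x ord0) (c - x ord0).
    by rewrite -(opprB c) dotNl dotC dotNl opprK.
  by rewrite -dotB opprB addrA subrK.
split=> [[r sx]|Ac].
- apply/colP => i; rewrite edgesE mxE.
  have : edist (x (lift ord0 i)) c = edist (x ord0) c.
    by rewrite (sx (x (lift ord0 i)))//= ?(sx (x ord0)) //=; [exists ord0|exists (lift ord0 i)].
  move=> /(congr1 (fun z => z ^+ 2)); rewrite !sqr_sqrtr// key => h.
  by lra.
- exists (edist (x ord0) c) => _ [i _ <-] /=.
  case: (unliftP ord0 i) => [j ->|->]//; congr Num.sqrt.
  have /colP/(_ j) := Ac; rewrite edgesE mxE key => h.
  by lra.
Qed.

Lemma circumsphere_unique (X : fcluster R d) (c c' : V) (r r' : R) :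
  full_simplex X -> cluster_set X `<=` esphere c r ->
  cluster_set X `<=` esphere c' r' -> c = c' /\ r = r'.
Proof.
move=> [x ai ->] s s'.
have cc' : c = c'.
  have /(congr1 (mulmx (invmx (edges x)))) : edges x *m (c - x ord0)^T = edges x *m (c' - x ord0)^T.
    transitivity (\col_i (2^-1 *
      dot (x (lift ord0 i) - x ord0) (x (lift ord0 i) - x ord0))).
      by apply/esphere_edges; exists r.
    by apply/esym/esphere_edges; exists r'.
  by rewrite !mulKmx ?edges_unit// => /trmx_inj /addIr.
split=> //; rewrite -cc' in s'.
have x0 : range x (x ord0) by exists ord0.
by rewrite -(s _ x0) -(s' _ x0).
Qed.

Lemma circumsphereP (X : fcluster R d) : full_simplex X ->
  cluster_set X `<=` esphere (circumcenter X) (circumradius X).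
Proof.
move=> sX; suff [cr h] : exists cr : V * R,
    cluster_set X `<=` esphere cr.1 cr.2.
  by exact: (@getI _ [set cr : V * R | cluster_set X `<=` esphere cr.1 cr.2] cr h).
have [x ai ->] := sX.
pose b := \col_i (2^-1 *
  dot (x (lift ord0 i) - x ord0) (x (lift ord0 i) - x ord0)).
have [r hr] : exists r, range x `<=` esphere (x ord0 + (invmx (edges x) *m b)^T) r.
  by apply/esphere_edges; rewrite addrC addKr trmxK mulKVmx ?edges_unit.
by exists (x ord0 + (invmx (edges x) *m b)^T, r).
Qed.

Let edist_coord (x c : V) (i : 'I_d) : `|x ord0 i - c ord0 i| <= edist x c.
Proof.
rewrite -sqrtr_sqr ler_wsqrtr// /dot (bigD1 i)//= !mxE -expr2 lerDl.
by apply: sumr_ge0 => j _; rewrite -expr2 sqr_ge0.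
Qed.

Lemma locally_finite_DR (r : R) (eta : config R d) :
  locally_finite_clusters (clusters_of_type (DR r) eta).
Proof.
move=> B [M0 [_ BM0]]; pose M := M0 + 1.
have {BM0}BM x : B x -> `|x| <= M.
  by move=> Bx; apply: (BM0 M) => //; rewrite ltrDl.
pose B' : set V := [set y | `|y| <= `|M| + `|r| *+ 2].
have fB' : finite_set (eta `&` B').
  apply: (config_lf eta); exists (`|M| + `|r| *+ 2); split; first exact: num_real.
  by move=> e he y yB'; apply: le_trans yB' (ltW he).
pose S : {fset V} := fset_set (eta `&` B').
apply: (@sub_finite_set _ _ [set` fpowerset S]); last exact: finite_fset.
move=> X [[Xeta [sX _ rX]] [x [Xx Bx]]] /=.
rewrite fpowersetE; apply/fsubsetP => y Xy.
rewrite in_fset_set// inE; split; first exact: Xeta.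
rewrite /B' /= [leLHS]mx_normrE; apply: bigmax_le => [|[i j] _].
  by rewrite addr_ge0// mulrn_wge0.
rewrite ord1 /=.
have hx : edist x (circumcenter X) = circumradius X by exact: circumsphereP.
have hy : edist y (circumcenter X) = circumradius X by exact: circumsphereP.
have := edist_coord x (circumcenter X) j; have := edist_coord y (circumcenter X) j.
rewrite hx hy => /le_trans/(_ rX) h1 /le_trans/(_ rX) h2.
have h3 : `|x ord0 j| <= `|M|.
  apply: le_trans (le_trans (BM _ Bx) (ler_norm M)).
  rewrite [leRHS]mx_normrE; exact: (le_bigmax _ (fun ij => `|x ij.1 ij.2|) (ord0, j)).
have rr := ler_norm r.
rewrite -[y ord0 j](subrK (circumcenter X ord0 j)).
apply: le_trans (ler_normD _ _) _.
rewrite -[circumcenter X ord0 j](subrK (x ord0 j)).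
have := ler_normD (circumcenter X ord0 j - x ord0 j) (x ord0 j).
rewrite subrK -(distrC (x ord0 j)).
by rewrite mulr2n; lra.
Qed.

Definition phi_DR (r : R) (eta : config R d) : cconfig R d :=
  CConfig (@locally_finite_DR r eta).

End circumball.

(* Main.v *)
Require Import Defs.
From HB Require Import structures.
From mathcomp Require Import all_boot all_order all_algebra finmap.
From mathcomp Require Import ring lra.
From mathcomp Require Import all_classical all_reals all_analysis measurable_realfun.

(** A Delaunay simplex of a locally finite set eta is one whose circumball
    contains no further point of eta.  The clusters kept by [phi_DR] tessellate,
    [phi_DR] is measurable, and its range lies in an event that consists of
    tessellations.

    Geometry.  The power of a point with respect to a sphere of center c and
    radius s is |x - c|^2 - s^2.  The difference of the powers with respect to
    two circumspheres is affine; on the vertices of one simplex it has one sign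
    and on the vertices of the other simplex the opposite sign, because each
    circumball is empty, and it vanishes exactly at the common vertices
    ([power_bisector]).  Hence the bisecting hyperplane supports both hulls and
    cuts each of them in the hull of the common vertices ([delaunay_face]).
    Vertices are exposed by the tangent hyperplanes of the circumsphere
    ([full_simplex_polytope]), and local finiteness follows from the bound on
    the radii ([delaunay_tessellation]).

    Measurability.  Whether some points of a random set satisfy an open relation
    is decided by countably many events of the form: the set hits a rational
    ball ([measurable_tuple_hits]).  In terms of determinants, being a simplex
    and having a large circumradius are open relations between the vertices, and
    having a circumball that contains a further point of eta is a countable
    intersection of such relations; so [DR r] is a measurable set of pairs
    ([measurable_DR]).  To count the subclusters of eta in a window which
    satisfy a measurable relation with eta, a monotone class argument
    ([measurable_counting_section]) reduces to clusters that avoid a given set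
    B, and eta has 2 ^ n of these, with n the number of its points in the window
    outside B.  Letting the window grow gives [measurable_phi_DR].

    Concentration.  The set of tessellations need not be measurable.  A cluster
    configuration whose clusters are Delaunay in the union of all its own
    clusters is a tessellation by the geometric part; these configurations form
    a measurable set ([measurable_self_delaunay]) which contains the whole range
    of [phi_DR]. *)

Set Implicit Arguments.
Unset Strict Implicit.
Unset Printing Implicit Defensive.

Import Order.TTheory GRing.Theory Num.Theory.
Import numFieldNormedType.Exports.

Local Open Scope classical_set_scope.
Local Open Scope ring_scope.

(** * The Euclidean inner product *)

Section dot_product.
Context {R : realType} {d : nat}.
Local Notation V := 'rV[R]_d.
Implicit Types u v w x y c : V.

Lemma dotC u v : dot u v = dot v u.
Proof. by apply: eq_bigr => i _; rewrite mulrC. Qed.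

Lemma dotDl u v w : dot (u + v) w = dot u w + dot v w.
Proof. by rewrite -big_split; apply: eq_bigr => i _; rewrite mxE mulrDl. Qed.

Lemma dotZl (a : R) u w : dot (a *: u) w = a * dot u w.
Proof. by rewrite mulr_sumr; apply: eq_bigr => i _; rewrite mxE mulrA. Qed.

Lemma dotNl u w : dot (- u) w = - dot u w.
Proof. by rewrite -scaleN1r dotZl mulN1r. Qed.

Lemma dotBl u v w : dot (u - v) w = dot u w - dot v w.
Proof. by rewrite dotDl dotNl. Qed.

Lemma dotBr u v w : dot w (u - v) = dot w u - dot w v.
Proof. by rewrite dotC dotBl !(dotC w). Qed.

Lemma dot_ge0 u : 0 <= dot u u.
Proof. by apply: sumr_ge0 => i _; rewrite -expr2 sqr_ge0. Qed.

Lemma dot_eq0 u : (dot u u == 0) = (u == 0).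
Proof.
apply/eqP/eqP => [u0|->]; last first.
  by rewrite /dot big1// => i _; rewrite mxE mul0r.
apply/rowP => i; rewrite mxE; apply/eqP.
rewrite -sqrf_eq0 expr2.
have /psumr_eq0P : forall j : 'I_d, true -> 0 <= u ord0 j * u ord0 j.
  by move=> j _; rewrite -expr2 sqr_ge0.
by move=> /(_ u0)/(_ i isT) ->.
Qed.

Lemma dot_conv u x y (k : {i01 R}) :
  dot u (conv k (x : convex_lmodType V) y) =
  k%:num * dot u x + (1 - k%:num) * dot u y.
Proof. by rewrite dotC dotDl !dotZl !(dotC u). Qed.

Lemma edist_ge0 x c : 0 <= Defs.edist x c.
Proof. exact: sqrtr_ge0. Qed.

Lemma sqr_edist x c : Defs.edist x c ^+ 2 = dot (x - c) (x - c).
Proof. by rewrite sqr_sqrtr// dot_ge0. Qed.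

Lemma edistP x c (r : R) : 0 <= r ->
  Defs.edist x c = r <-> dot (x - c) (x - c) = r ^+ 2.
Proof.
move=> r0; rewrite -sqr_edist; split=> [->//|/eqP].
by rewrite eqrXn2 ?edist_ge0// => /eqP.
Qed.

Lemma edist_le x c (r : R) : 0 <= r ->
  (Defs.edist x c <= r) = (dot (x - c) (x - c) <= r ^+ 2).
Proof. by move=> r0; rewrite -sqr_edist ler_sqr ?nnegrE ?edist_ge0. Qed.

Lemma ler_edist_coord x c i : `|x ord0 i - c ord0 i| <= Defs.edist x c.
Proof.
rewrite -sqrtr_sqr ler_wsqrtr// /dot (bigD1 i)//= !mxE -expr2 lerDl.
by apply: sumr_ge0 => j _; rewrite -expr2 sqr_ge0.
Qed.

End dot_product.

(** * Convex hulls and their faces *)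

Section convex_hull.
Context {R : realType} {d : nat}.
Local Notation V := 'rV[R]_d.
Implicit Types (u x c : V) (A C : set V) (b : R).

Lemma sub_conv_hull A : A `<=` conv_hull A.
Proof. by move=> x Ax C [_]; apply. Qed.

Lemma conv_hull_sub A C : convex_set (C : set (convex_lmodType V)) ->
  A `<=` C -> conv_hull A `<=` C.
Proof. by move=> cC AC x; apply. Qed.

Lemma conv_hullS A C : A `<=` C -> conv_hull A `<=` conv_hull C.
Proof. by move=> AC x Ax D [cD CD]; apply: Ax; split=> // y /AC/CD. Qed.

Lemma convex_conv_hull A :
  convex_set (conv_hull A : set (convex_lmodType V)).
Proof.
move=> x y k /set_mem hx /set_mem hy; apply/mem_set => C [cC AC].
by have /set_mem := cC x y k (mem_set (hx C (conj cC AC)))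
  (mem_set (hy C (conj cC AC))).
Qed.

(** A supporting hyperplane of a hull cuts it in the hull of the generators on
    the hyperplane.  The points x for which the conclusion holds form a convex
    set: a proper convex combination of two points of the half-space lies on
    the bounding hyperplane only if both points do. *)
Lemma conv_hull_face A u b x : (forall a, A a -> dot u a <= b) ->
  conv_hull A x ->
  dot u x <= b /\
  (dot u x = b -> conv_hull (A `&` [set a | dot u a = b]) x).
Proof.
move=> Ab; move: x; apply: (@conv_hull_sub _ [set x | dot u x <= b /\
  (dot u x = b -> conv_hull (A `&` [set a | dot u a = b]) x)]); last first.
  move=> a Aa; split; first exact: Ab.
  by move=> ab; apply: sub_conv_hull.
apply/convex_setW => x y /set_mem[xb hx] /set_mem[yb hy] k k0 k1.
apply/mem_set; rewrite /= dot_conv.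
have k1' : 0 < 1 - k%:num by rewrite subr_gt0.
have kx : k%:num * dot u x <= k%:num * b by rewrite ler_pM2l.
have ky : (1 - k%:num) * dot u y <= (1 - k%:num) * b by rewrite ler_pM2l.
have kb : k%:num * b + (1 - k%:num) * b = b by rewrite -mulrDl subrKC mul1r.
split; first by rewrite -[leRHS]kb lerD.
move=> e; apply/set_mem; apply: convex_conv_hull; apply/mem_set.
- by apply: hx; apply: (mulfI (lt0r_neq0 k0)); lra.
- by apply: hy; apply: (mulfI (lt0r_neq0 k1')); lra.
Qed.

Lemma conv_hull1 x : conv_hull [set x] = [set x].
Proof.
apply: smallest_id => y z k /set_mem -> /set_mem ->.
by rewrite convmm; apply/mem_set.
Qed.

Lemma conv_hull_coord A c (s : R) :
  (forall a i, A a -> `|a ord0 i - c ord0 i| <= s) ->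
  forall x i, conv_hull A x -> `|x ord0 i - c ord0 i| <= s.
Proof.
move=> As x i.
apply: (@conv_hull_sub A [set y : V | `|y ord0 i - c ord0 i| <= s]).
  move=> y z k /set_mem /= hy /set_mem /= hz; apply/mem_set; rewrite /=.
  rewrite (_ : conv k y z = k%:num *: (y : V) + (1 - k%:num) *: (z : V))// !mxE.
  rewrite (_ : _ + _ - _ = k%:num * (y ord0 i - c ord0 i) +
                       (1 - k%:num) * (z ord0 i - c ord0 i)); last first.
    by ring.
  have k1 : 0 <= (1 - k%:num) by rewrite subr_ge0.
  have kb : k%:num * s + (1 - k%:num) * s = s by rewrite -mulrDl subrKC mul1r.
  rewrite (le_trans (ler_normD _ _))// !normrM (ger0_norm k1) ger0_norm//.
  by rewrite -[leRHS]kb lerD// ler_wpM2l.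
by move=> a Aa; exact: As.
Qed.

End convex_hull.

(** * Delaunay simplices form a face-to-face tiling *)

Section delaunay.
Context {R : realType} {d : nat}.
Local Notation V := 'rV[R]_d.
Implicit Types (X : fcluster R d) (x y : V) (eta : config R d).

Lemma affinely_independent_inj n (x : 'I_n -> V) :
  affinely_independent x -> injective x.
Proof.
move=> ai i j xij; apply: contrapT => /eqP ij.
pose a k : R := (k == i)%:R - (k == j)%:R.
have delta k (y : V) : \sum_l (l == k)%:R *: (x l - y) = x k - y.
  rewrite (bigD1 k)//= eqxx scale1r big1 ?addr0// => l /negPf->.
  by rewrite scale0r.
have delta1 k : \sum_l (l == k :> 'I_n)%:R = 1 :> R.
  by rewrite (bigD1 k)//= eqxx big1 ?addr0// => l /negPf->.
have /(_ i) : forall i, a i = 0.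
  apply: ai; first by rewrite sumrB !delta1 subrr.
  under eq_bigr do rewrite scalerBl -[x _]subr0.
  by rewrite sumrB !delta xij subrr.
by rewrite /a eqxx (negPf ij) subr0 => /eqP; rewrite oner_eq0.
Qed.

Lemma circumradius_ge0 X : full_simplex X -> 0 <= circumradius X.
Proof.
move=> sX; have [x _ Xx] := sX.
have /(circumsphereP sX) <- : cluster_set X (x ord0) by rewrite Xx; exists ord0.
exact: edist_ge0.
Qed.

Lemma dot_circumcenter X : full_simplex X -> forall x, cluster_set X x ->
  dot (x - circumcenter X) (x - circumcenter X) = circumradius X ^+ 2.
Proof.
by move=> sX x Xx; apply/edistP; [exact: circumradius_ge0|exact: circumsphereP].
Qed.

(** The hyperplane tangent at the vertex a to the circumsphere exposes a: for a
    point x of the same sphere, |x - a|^2 is twice the amount by which x lies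
    below the tangent hyperplane.  In positive dimension the simplex has two
    vertices, so that its circumradius is positive and the tangent hyperplane
    is defined. *)
Lemma full_simplex_polytope X : (1 <= d)%N -> full_simplex X ->
  discrete_polytope X.
Proof.
move=> d1 sX a Xa; set c := circumcenter X; set u := a - c.
have uX x : cluster_set X x ->
    dot u x <= dot u a /\ (dot u x = dot u a -> x = a).
  move=> Xx; have e : dot (x - a) (x - a) = 2 * (dot u a - dot u x).
    have := dot_circumcenter sX Xx; have := dot_circumcenter sX Xa.
    rewrite -/c /u !(dotBl, dotBr) (dotC x a) (dotC x c) (dotC a c); lra.
  split; first by have := dot_ge0 (x - a); rewrite e; lra.
  move=> xa; apply/eqP; rewrite -subr_eq0 -dot_eq0 e xa subrr mulr0//.
exists [set x | dot u x = dot u a]; last first.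
  apply/seteqP; split => [x [ux Cx]|x ->]; last first.
    by split => //; exact: sub_conv_hull.
  have [_ /(_ ux)] := conv_hull_face (fun y Xy => (uX y Xy).1) Cx.
  move/(@conv_hullS _ _ _ [set a]); rewrite conv_hull1; apply.
  by move=> y [Xy /(uX y Xy).2].
exists u, (dot u a); split => //; last 2 first.
- move=> x Cx; exact: (conv_hull_face (fun y Xy => (uX y Xy).1) Cx).1.
- by exists a; split => //; exact: sub_conv_hull.
apply/eqP => u0.
have all_a x : cluster_set X x -> x = a.
  move=> Xx; apply: (uX x Xx).2.
  by rewrite u0 /dot !big1// => i _; rewrite mxE mul0r.
have [x ai Xx] := sX.
have xa i : x i = a by apply: all_a; rewrite Xx; exists i.
have : x ord0 = x ord_max by rewrite !xa.
by move/(affinely_independent_inj ai)/(congr1 val) => /= d0; rewrite -d0 in d1.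
Qed.

Lemma conv_hull_nonempty X z : conv_hull X z -> X !=set0.
Proof.
move=> Xz; apply/set0P/eqP => X0; suff : conv_hull X `<=` set0 by move/(_ z Xz).
by rewrite X0; apply: conv_hull_sub => // x y k /set_mem [].
Qed.

Section empty_circumballs.
Variables (r : R) (eta : config R d).
Local Notation phi := (clusters_of_type (DR r) eta).

Lemma delaunay_in_ball X y : phi X -> config_set eta y ->
  Defs.edist y (circumcenter X) <= circumradius X -> cluster_set X y.
Proof.
move=> [_ [_ /= e _]] ey yK; apply: contrapT => nXy.
by move/seteqP : e => [/(_ y) + _]; apply; split.
Qed.

(** The hyperplane [dot u x = b] is the set of points which have the same power
    with respect to the two circumspheres.  A vertex of X has power 0 for its
    own sphere; as the other circumball contains no point of eta apart from its
    vertices, its power for the other sphere is positive, or it is a vertex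
    there too and this power is 0. *)
Lemma power_bisector X X' (c := circumcenter X) (c' := circumcenter X')
    (u := c' - c)
    (b := (dot c' c' - circumradius X' ^+ 2
           - dot c c + circumradius X ^+ 2) / 2) :
  phi X -> phi X' -> forall x, cluster_set X x ->
  dot u x <= b /\ (dot u x = b -> cluster_set X' x).
Proof.
move=> pX pX' x Xx; have [Xeta [sX _ _]] := pX; have [X'eta [sX' _ _]] := pX'.
have e : dot (x - c') (x - c') - circumradius X' ^+ 2 = 2 * (b - dot u x).
  have := dot_circumcenter sX Xx; rewrite -/c /u /b.
  rewrite !(dotBl, dotBr) (dotC x c) (dotC x c'); lra.
have H : dot (x - c') (x - c') <= circumradius X' ^+ 2 -> cluster_set X' x.
  rewrite -edist_le ?circumradius_ge0//.
  by apply: delaunay_in_ball => //; exact: Xeta.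
split; last by move=> ub; apply: H; lra.
rewrite leNgt; apply/negP => ub.
have /(dot_circumcenter sX') : cluster_set X' x by apply: H; lra.
by rewrite -/c'; lra.
Qed.

(** The bisecting hyperplane separates the hulls and contains their
    intersection.  Concentric spheres have no bisector, but then the power of
    every vertex of either simplex for the other sphere vanishes, and the two
    simplices have the same vertices. *)
Lemma delaunay_face X X' : phi X -> phi X' ->
  conv_hull X `&` conv_hull X' !=set0 ->
  face (conv_hull X) (conv_hull X `&` conv_hull X').
Proof.
move=> pX pX' [z [Xz X'z]].
have gX := power_bisector pX pX'; have gX' := power_bisector pX' pX.
have [_ [sX _ _]] := pX; have [_ [sX' _ _]] := pX'.
move: gX gX'; set c := circumcenter X; set c' := circumcenter X'.
set b := _ / 2; set b' := _ / 2 => gX gX'.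
have bb' : b' = - b by rewrite /b /b'; lra.
have uu' x : dot (c - c') x = - dot (c' - c) x by rewrite !dotBl; ring.
have hX := conv_hull_face (fun y Xy => (gX y Xy).1).
have hX' := conv_hull_face (fun y Xy => (gX' y Xy).1).
have zb : dot (c' - c) z = b.
  apply/eqP; rewrite eq_le (hX z Xz).1/=.
  by have := (hX' z X'z).1; rewrite uu' bb' lerN2.
have [u0|u0] := eqVneq (c' - c) 0; [left|right].
  have d0 x : dot (c' - c) x = 0.
    by rewrite u0 /dot big1// => i _; rewrite mxE mul0r.
  have b0 : b = 0 by rewrite -zb d0.
  have XX' : cluster_set X = cluster_set X'.
    apply/seteqP; split => x Xx; [apply: (gX x Xx).2|apply: (gX' x Xx).2].
      by rewrite d0 b0.
    by rewrite uu' d0 bb' b0.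
  by rewrite XX' setIid.
exists [set x | dot (c' - c) x = b].
  exists (c' - c), b; split => //; first by move=> x /hX[].
  by exists z.
apply/seteqP; split => x [Cx].
  move=> C'x; split=> //=; apply/eqP; rewrite eq_le (hX x Cx).1/=.
  by have := (hX' x C'x).1; rewrite uu' bb' lerN2.
move=> /= xb; split=> //; have [_ /(_ xb)] := hX x Cx.
by apply: conv_hullS => y [Xy /(gX y Xy).2].
Qed.

End empty_circumballs.

Lemma bounded_cube (B : set V) (s : R) : bounded_set B ->
  exists2 M, (forall x, B x -> forall i, `|x ord0 i| <= M) &
    bounded_set [set x : V | forall i, `|x ord0 i| <= M + s].
Proof.
move=> [M0 [_ BM0]]; exists (`|M0| + 1).
  move=> x Bx i; have /(BM0 (`|M0| + 1))/(_ x Bx) : M0 < `|M0| + 1.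
    by rewrite (le_lt_trans (ler_norm _))// ltrDl.
  apply: le_trans; rewrite [leRHS]mx_normrE.
  exact: (le_bigmax _ (fun ij => `|x ij.1 ij.2|) (ord0, i)).
exists (`|M0| + 1 + `|s|); split; first exact: num_real.
move=> e he x /= xM; rewrite [leLHS]mx_normrE.
apply: bigmax_le => [|[i j] _]; first by rewrite (le_trans _ (ltW he)).
rewrite ord1/= (le_trans (xM j))// (le_trans _ (ltW he))//.
by rewrite lerD2l ler_norm.
Qed.

(** Stated for any family of Delaunay clusters of eta, so that eta may also be
    the set of all vertices of the family itself. *)
Lemma delaunay_tessellation (r : R) eta (mu : cconfig R d) : (1 <= d)%N ->
  cconfig_set mu `<=` clusters_of_type (DR r) eta -> cluster_tessellation mu.
Proof.
move=> d1 muD; split=> [X /muD[_ [sX _ _]]|].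
  exact: full_simplex_polytope.
split; last first.
  move=> _ _ [X /muD pX <-] [X' /muD pX' <-] XX'; split.
    exact: delaunay_face pX pX' XX'.
  by rewrite setIC; apply: delaunay_face pX' pX _; rewrite setIC.
move=> B /(bounded_cube (r *+ 2))[M BM /(cconfig_lf mu) fB].
apply: sub_finite_set (finite_image (fun X => conv_hull (cluster_set X)) fB).
move=> _ [[X pX <-] [z [Xz Bz]]]; exists X => //; split=> //.
have [x Xx] := conv_hull_nonempty Xz; exists x; split => // i.
have [_ [sX _ /= Xr]] := muD _ pX.
have coord a j : cluster_set X a ->
    `|a ord0 j - circumcenter X ord0 j| <= r.
  move=> Xa; apply: le_trans (ler_edist_coord _ _ _) _.
  by rewrite (circumsphereP sX Xa).
have hx := coord x i Xx.
have hz := conv_hull_coord coord i Xz.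
have := BM z Bz i.
move: hx hz; rewrite !ler_norml mulr2n; lra.
Qed.

End delaunay.

(** * Continuity properties of cardinalities *)

Section counting_lemmas.
Context {R : realType} {T : pointedType}.
Local Notation cnt := (@counting T R).

(** Limit properties of a measure concern measurable sets.  The value of
    [counting] does not refer to a sigma-algebra, so they may be applied with the
    one that contains all sets. *)
Lemma counting_bigcup (F : (set T)^nat) : trivIset setT F ->
  cnt (\bigcup_n F n) = (\sum_(n <oo) cnt (F n))%E.
Proof.
move=> tF.
pose mu : {measure set (g_sigma_algebraType [set: set T]) -> \bar R} :=
  @counting _ R.
have m (A : set (g_sigma_algebraType [set: set T])) : measurable A.
  exact: sub_sigma_algebra.
exact: (@measure_semi_bigcup _ _ _ mu).
Qed.

Lemma counting_cvg (F : (set T)^nat) : nondecreasing_seq F ->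
  cnt (F n) @[n --> \oo] --> cnt (\bigcup_n F n).
Proof.
move=> ndF.
pose mu : {measure set (g_sigma_algebraType [set: set T]) -> \bar R} :=
  @counting _ R.
have m (A : set (g_sigma_algebraType [set: set T])) : measurable A.
  exact: sub_sigma_algebra.
exact: (@nondecreasing_cvg_mu _ _ _ mu).
Qed.

Lemma counting_setD (A B : set T) : finite_set A -> B `<=` A ->
  cnt (A `\` B) = (cnt A - cnt B)%E.
Proof.
move=> fA BA; have fB := sub_finite_set BA fA.
have fAB : finite_set (A `\` B) by apply: finite_setD.
rewrite /counting !asboolT// -EFinB fset_setD//; congr EFin.
have BA' : (fset_set B `<=` fset_set A)%fset by rewrite -fset_set_sub.
by rewrite cardfsDS// natrB// fsubset_leq_card.
Qed.

End counting_lemmas.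

(** * Random sets and open relations between their points *)

Section hitting.
Context {R : realType} {d : nat}.
Local Notation V := 'rV[R]_d.

Lemma bounded_ball (c : V) (e : R) : bounded_set (ball c e).
Proof.
exists (`|c| + e); split; first exact: num_real.
move=> M cM x; rewrite -ball_normE/= => xc; apply/ltW/(le_lt_trans _ cM).
rewrite -[x](subrK c) addrC (le_trans (ler_normD _ _))// lerD2l.
by rewrite distrC ltW.
Qed.

Lemma sub_bounded (A B : set V) : A `<=` B -> bounded_set B -> bounded_set A.
Proof.
by move=> AB [M [Mr BM]]; exists M; split=> // e Me x /AB; exact: BM.
Qed.

Lemma rational_matrix_approx m n (M : 'M[R]_(m, n)) (e : R) : 0 < e ->
  exists q : 'M[rat]_(m, n), ball (map_mx (ratr : rat -> R) q) e M.
Proof.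
move=> e0; have h i j : exists q : rat, ball (ratr q : R) e (M i j).
  have [q] := @rat_in_itvoo R (M i j - e) (M i j + e) ltac:(by lra).
  rewrite in_itv/= => /andP[q1 q2]; exists q.
  by rewrite /ball/= ltr_distlC; apply/andP; lra.
have [q hq] := choice (fun ij => h ij.1 ij.2).
exists (\matrix_(i, j) q (i, j)); split=> // i j; rewrite !mxE.
exact: (hq (i, j)).
Qed.

Lemma row_ball m (M N : 'M[R]_(m, d)) (e : R) : 0 < e ->
  ball M e N <-> forall i, ball (row i M) e (row i N).
Proof.
move=> e0; split=> [[_ MN] i|MN].
  by split=> // k j; rewrite !mxE.
split=> // i j; have [_ /(_ ord0 j)] := MN i.
by rewrite !mxE.
Qed.

Section measurable_hits.
Context {disp : measure_display} {T : measurableType disp}.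

(** Effros measurability of a random set; bounded open sets suffice, because every
    open set is a countable union of them. *)
Definition measurable_hits (s : T -> set V) := forall B : set V,
  open B -> bounded_set B -> measurable [set t | s t `&` B !=set0].

(** If the tuple M satisfies the open relation U, so do all tuples whose entries
    lie in small rational balls around the entries of M.  The event is
    therefore the countable union, over the products of rational balls contained
    in U, of the events that each random set hits its ball. *)
Lemma measurable_tuple_hits k (s : 'I_k -> T -> set V) (U : set 'M[R]_(k, d)) :
  open U -> (forall i, measurable_hits (s i)) ->
  measurable [set t | exists2 M, U M & forall i, s i t (row i M)].
Proof.
move=> oU ms.
pose ctr (p : 'M[rat]_(k, d) * nat) := map_mx (ratr : rat -> R) p.1.
pose rad (p : 'M[rat]_(k, d) * nat) : R := p.2.+1%:R^-1.
have rad0 p : 0 < rad p by rewrite invr_gt0.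
pose F p : set T := if `[< ball (ctr p) (rad p) `<=` U >] then
  \bigcap_(i in [set: 'I_k])
    [set t | s i t `&` ball (row i (ctr p)) (rad p) !=set0]
  else set0.
rewrite (_ : [set _ | _] = \bigcup_p F p); last first.
  apply/seteqP; split=> [t [M UM sM]|t [p _]]; last first.
    rewrite /F; case: ifPn => // /asboolP pU tp.
    have /choice[x hx] : forall i, exists x,
        (s i t `&` ball (row i (ctr p)) (rad p)) x by move=> i; exact: tp.
    have rx i : row i (\matrix_i x i) = x i by rewrite rowK.
    exists (\matrix_i x i); last by move=> i; rewrite rx; exact: (hx i).1.
    by apply/pU/row_ball => // i; rewrite rx; exact: (hx i).2.
  have /nbhs_ballP[e /= e0 eU] : nbhs M U by apply: open_nbhs_nbhs.
  have [n ne] : exists n, n.+1%:R^-1 < e / 2.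
    have := near_infty_natSinv_lt (PosNum (divr_gt0 e0 (ltr0Sn R 1))).
    by move=> [n _ /(_ n (leqnn n))] /= ?; exists n.
  have n0 : 0 < n.+1%:R^-1 :> R by rewrite invr_gt0.
  have [q qM] := rational_matrix_approx M n0.
  exists (q, n) => //; rewrite /F; rewrite asboolT; last first.
    move=> N qN; apply: eU; apply: le_ball (ball_triangle (ball_sym qM) qN).
    by rewrite /rad/= (splitr e) lerD// ltW.
  move=> i _; exists (row i M); split; first exact: sM.
  by move/row_ball : qM; apply.
apply: countable_bigcupT_measurable => // p; rewrite /F.
case: ifPn => // _.
apply: fin_bigcap_measurable => // i _.
by apply: ms; [exact: ball_open|exact: bounded_ball].
Qed.

End measurable_hits.

End hitting.

(** * Open conditions given by polynomials in matrix entries *)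

Section polynomial_continuity.
Context {R : realType} {T : topologicalType}.

Definition continuous_mx m n (A : T -> 'M[R]_(m, n)) :=
  forall i j, continuous (fun t => A t i j).

Lemma continuous_sumr (I : Type) (r : seq I) (P : pred I) (f : I -> T -> R) :
  (forall i, P i -> continuous (f i)) ->
  continuous (fun t => \sum_(i <- r | P i) f i t).
Proof. by apply: continuous_big; exact: add_continuous. Qed.

Lemma continuous_prodr (I : Type) (r : seq I) (P : pred I) (f : I -> T -> R) :
  (forall i, P i -> continuous (f i)) ->
  continuous (fun t => \prod_(i <- r | P i) f i t).
Proof. by apply: continuous_big; exact: mul_continuous. Qed.

Lemma continuous_mulr (f g : T -> R) : continuous f -> continuous g ->
  continuous (fun t => f t * g t).
Proof. by move=> cf cg t; exact: cvgM (cf t) (cg t). Qed.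

Lemma continuous_subr (f g : T -> R) : continuous f -> continuous g ->
  continuous (fun t => f t - g t).
Proof. by move=> cf cg t; exact: cvgB (cf t) (cg t). Qed.

Lemma open_lt_continuous (f g : T -> R) : continuous f -> continuous g ->
  open [set t | f t < g t].
Proof.
move=> cf cg.
rewrite (_ : [set _ | _] = (fun t => g t - f t) @^-1` [set y | 0 < y]).
  apply: open_comp (@open_gt _ 0) => t _; exact: continuous_subr.
by apply/seteqP; split=> t /=; rewrite subr_gt0.
Qed.

Lemma continuous_mulmx m n p (A : T -> 'M[R]_(m, n)) (B : T -> 'M[R]_(n, p)) :
  continuous_mx A -> continuous_mx B -> continuous_mx (fun t => A t *m B t).
Proof.
move=> cA cB i j; under eq_fun do rewrite mxE.
by apply: continuous_sumr => k _; apply: continuous_mulr; [exact: cA|exact: cB].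
Qed.

Lemma continuous_det n (A : T -> 'M[R]_n) :
  continuous_mx A -> continuous (fun t => \det (A t)).
Proof.
move=> cA; apply: continuous_sumr => s _; apply: continuous_mulr.
  exact: cst_continuous.
by apply: continuous_prodr => i _; exact: cA.
Qed.

Lemma continuous_adj n (A : T -> 'M[R]_n) :
  continuous_mx A -> continuous_mx (fun t => \adj (A t)).
Proof.
move=> cA i j; under eq_fun do rewrite mxE.
apply: continuous_mulr; first exact: cst_continuous.
apply: continuous_det => k l; under eq_fun do rewrite !mxE.
exact: cA.
Qed.

Lemma continuous_dot n (u v : T -> 'rV[R]_n) :
  continuous_mx u -> continuous_mx v -> continuous (fun t => dot (u t) (v t)).
Proof.
move=> cu cv; apply: continuous_sumr => i _.
by apply: continuous_mulr; [exact: cu|exact: cv].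
Qed.

Lemma continuous_subrow n (u v : T -> 'rV[R]_n) :
  continuous_mx u -> continuous_mx v -> continuous_mx (fun t => u t - v t).
Proof.
move=> cu cv i j; under eq_fun do rewrite !mxE.
by apply: continuous_subr; [exact: cu|exact: cv].
Qed.

End polynomial_continuity.

Lemma continuous_row {R : realType} m n (i : 'I_m) :
  continuous_mx (fun M : 'M[R]_(m, n) => row i M).
Proof.
move=> k j; under eq_fun do rewrite mxE.
exact: coord_continuous.
Qed.

(** * The cardinality of a random finite set *)

Section counting_points.
Context {R : realType} {d : nat}.
Local Notation V := 'rV[R]_d.

(** A polynomial in the entries which is positive exactly when the rows are
    pairwise distinct; this makes distinctness an open relation. *)
Definition distinct_rows k (M : 'M[R]_(k, d)) :=
  \prod_(p : 'I_k * 'I_k | p.1 != p.2)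
    dot (row p.1 M - row p.2 M) (row p.1 M - row p.2 M).

Lemma distinct_rowsP k (M : 'M[R]_(k, d)) :
  0 < distinct_rows M <-> injective (fun i => row i M).
Proof.
split=> [M0 i j ij|Mi]; last first.
  apply: prodr_gt0 => -[i j]/= ij; rewrite lt0r dot_ge0 andbT dot_eq0 subr_eq0.
  by apply: contra ij => /eqP/Mi ->.
apply: contrapT => /eqP nij; suff M00 : distinct_rows M = 0.
  by rewrite M00 ltxx in M0.
apply/eqP; rewrite prodf_seq_eq0; apply/hasP; exists (i, j) => //=.
  by rewrite mem_index_enum.
by rewrite nij /= ij subrr dot_eq0.
Qed.

Lemma open_distinct_rows k : open [set M : 'M[R]_(k, d) | 0 < distinct_rows M].
Proof.
apply: open_lt_continuous; first exact: cst_continuous.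
apply: continuous_prodr => p _; apply: continuous_dot;
  by apply: continuous_subrow; exact: continuous_row.
Qed.

Definition npoints k (S : set V) :=
  exists2 M : 'M[R]_(k, d), injective (fun i => row i M) &
    forall i, S (row i M).

Lemma npointsP k (S : {fset V}) : npoints k [set` S] <-> (k <= #|` S|)%N.
Proof.
split=> [[M Mi SM]|kS].
  have <- : #|` [fset row i M | i : 'I_k]%fset| = k.
    by rewrite card_imfset//= size_enum_ord.
  by apply/fsubset_leq_card/fsubsetP => _ /imfsetP[i _ ->]; exact: SM.
have ltS (i : 'I_k) : (i < size S)%N by exact: leq_trans (ltn_ord i) kS.
pose x (i : 'I_k) : V := nth 0 S i.
have rx i : row i (\matrix_i x i) = x i by rewrite rowK.
exists (\matrix_i x i) => [i j|i]; rewrite !rx; last by rewrite /= mem_nth.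
by move/eqP; rewrite nth_uniq ?fset_uniq// => /eqP/val_inj.
Qed.

Context {disp : measure_display} {T : measurableType disp}.
Variable s : T -> set V.
Hypothesis ms : measurable_hits s.

Lemma measurable_npoints k : measurable [set t | npoints k (s t)].
Proof.
rewrite (_ : [set _ | _] = [set t | exists2 M : 'M[R]_(k, d),
    [set M | 0 < distinct_rows M] M & forall i, s t (row i M)]); last first.
  by apply/seteqP; split=> t [M Mi sM]; exists M => //; exact/distinct_rowsP.
exact: (@measurable_tuple_hits _ _ _ _ _ (fun=> s) _
  (@open_distinct_rows k) (fun=> ms)).
Qed.

(** Having at least k points is an open relation between k points, and the
    events of this form determine the cardinality. *)
Lemma measurable_counting (Y : set (\bar R)) : (forall t, finite_set (s t)) ->
  measurable [set t | Y (counting (s t))].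
Proof.
move=> fs; pose n t := #|` fset_set (s t)|.
have nP k t : npoints k (s t) <-> (k <= n t)%N.
  by rewrite -npointsP fset_setK.
rewrite (_ : [set _ | _] = \bigcup_(k in [set k | Y k%:R%:E])
    ([set t | npoints k (s t)] `\` [set t | npoints k.+1 (s t)])); last first.
  have cE t : counting (s t) = (n t)%:R%:E by rewrite /counting asboolT.
  apply/seteqP; split=> t /=.
    by rewrite cE => Yt; exists (n t) => //; split; rewrite /= nP ?ltnn.
  move=> [k Yk []]; rewrite /= !nP => kn /negP; rewrite -leqNgt => nk.
  by rewrite cE (_ : n t = k)//; apply/eqP; rewrite eqn_leq nk.
apply: bigcup_measurable => k _.
by apply: measurableD; exact: measurable_npoints.
Qed.

End counting_points.

(** * Bounded Borel sets *)

Section borel.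
Context {R : realType} {d : nat}.
Local Notation V := 'rV[R]_d.
Implicit Types (A B : set V).

Lemma bounded_borel_open B : open B -> bounded_set B -> bounded_borel B.
Proof. by move=> oB bB; split=> //; exact: sub_sigma_algebra. Qed.

Lemma bounded_borelI A B : bounded_borel A -> bounded_borel B ->
  bounded_borel (A `&` B).
Proof.
move=> [mA bA] [mB bB]; split.
  exact: (@measurableI _ (g_sigma_algebraType (@open V))).
by apply: sub_bounded bA => x [].
Qed.

Lemma bounded_borelD A B : bounded_borel A -> bounded_borel B ->
  bounded_borel (A `\` B).
Proof.
move=> [mA bA] [mB bB]; split.
  exact: (@measurableD _ (g_sigma_algebraType (@open V))).
by apply: sub_bounded bA => x [].
Qed.

Lemma bounded_borel0 : bounded_borel (set0 : set V).
Proof.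
apply: bounded_borel_open; first exact: open0.
by exists 0; split=> // M _ x [].
Qed.

Lemma bounded_borelU A B : bounded_borel A -> bounded_borel B ->
  bounded_borel (A `|` B).
Proof.
move=> [mA [a [ar bA]]] [mB [b [br bB]]]; split.
  exact: (@measurableU _ (g_sigma_algebraType (@open V))).
exists (Num.max a b); split; first exact: num_real.
by move=> M; rewrite gt_max => /andP[aM bM] x [/bA|/bB]; apply.
Qed.

End borel.

(** * Counting the points in a section of a measurable relation *)

Section counting_sections.
Context {R : realType}.

Lemma counting_eq0 {S : choiceType} (A : set S) :
  (counting A = 0 :> \bar R)%E <-> A = set0.
Proof.
rewrite /counting; case: ifPn => [/asboolP fA|/asboolP nfA]; last first.
  by split=> [//|A0]; case: nfA; rewrite A0.
split=> [[]|->]; last by rewrite fset_set0.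
by move/eqP; rewrite pnatr_eq0 cardfs_eq0 => /eqP/fset_set_set0; exact.
Qed.

Context {d1 d2 : measure_display}.
Context {S : measurableType d1} {T : measurableType d2}.
Variables (G : set (set S)) (k : T -> set S).
Hypothesis sG : @measurable _ S = <<s G >>.
Hypothesis GI : setI_closed G.
Hypothesis GT : G setT.
Hypothesis fk : forall t, finite_set (k t).
Hypothesis mk : forall A, G A ->
  measurable_fun setT (fun t => counting (k t `&` A) : \bar R).

Let rectangles : set (set (S * T)) :=
  [set E | exists2 A, G A & exists2 F, measurable F & E = A `*` F].

Let rectanglesI : setI_closed rectangles.
Proof.
move=> _ _ [A GA [F mF ->]] [B GB [H mH ->]].
exists (A `&` B); first exact: GI.
by exists (F `&` H); [exact: measurableI|rewrite setXI].
Qed.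

Let measurable_rectangles : @measurable _ (S * T)%type = <<s rectangles >>.
Proof.
apply/seteqP; split; last first.
  apply: smallest_sub; first exact: sigma_algebra_measurable.
  move=> _ [A GA [F mF ->]]; apply: measurableX => //.
  by rewrite sG; exact: sub_sigma_algebra.
apply: smallest_sub; first exact: smallest_sigma_algebra.
rewrite subUset; split=> [_ [A mA <-]|_ [F mF <-]]; rewrite setTI; last first.
  by apply: sub_sigma_algebra; exists setT => //; exists F => //; rewrite setTX.
suff : measurable_fun [set: g_sigma_algebraType rectangles]
    (fst : g_sigma_algebraType rectangles -> S).
  by move=> /(_ measurableT A mA); rewrite setTI.
apply: (measurability G) => // _ [B GB <-]; rewrite setTI.
by apply: sub_sigma_algebra; exists B => //; exists setT => //; rewrite setXT.
Qed.

(** The relations E for which the count is measurable form a Dynkin system: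
    complements need the finiteness of k t, and disjoint unions the
    sigma-additivity of counting.  For a rectangle A * F with A in G, the count
    is that of A on F and 0 elsewhere. *)
Lemma measurable_counting_section (E : set (S * T)) : measurable E ->
  measurable_fun setT
    (fun t => counting (k t `&` [set x | E (x, t)]) : \bar R).
Proof.
rewrite measurable_rectangles.
pose P (E : set (S * T)) := measurable_fun [set: T]
  (fun t => counting (k t `&` [set x | E (x, t)]) : \bar R).
have PT : P setT.
  rewrite /P (_ : (fun _ => _) = fun t => counting (k t `&` setT))//.
  exact: mk.
move: E; apply: (dynkin_induction measurable_rectangles rectanglesI PT).
- move=> _ [A GA [F mF ->]] _ Y mY; rewrite setTI.
  have cE t : counting (k t `&` [set x | (A `*` F) (x, t)]) =
      (if `[< F t >] then counting (k t `&` A) else 0%E) :> \bar R.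
    case: ifPn => /asboolP Ft.
      by congr counting; apply/seteqP; split=> x [kx]; [case|split].
    by apply/counting_eq0/seteqP; split=> x //= [_ []].
  rewrite (_ : _ @^-1` _ = (F `&` (fun t => counting (k t `&` A)) @^-1` Y)
      `|` (~` F `&` [set _ | Y 0%E])).
    apply: measurableU; apply: measurableI => //.
    - by have := mk GA measurableT mY; rewrite setTI.
    - exact: measurableC.
    - have [Y0|nY0] := pselect (Y 0%E).
        by rewrite (_ : [set _ | _] = setT)//; apply/seteqP; split.
      by rewrite (_ : [set _ | _] = set0)//; apply/seteqP; split=> // ? /nY0.
  apply/seteqP; split=> t; rewrite /preimage/= cE; case: ifPn => /asboolP Ft.
  + by left.
  + by right.
  + by case=> -[].
  + by case=> -[].
- move=> E _ PE; rewrite /P (_ : (fun _ => _) =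
    ((fun t => counting (k t `&` [set x | setT (x, t)]) : \bar R) \-
    (fun t => counting (k t `&` [set x | E (x, t)]) : \bar R))%E).
    exact: emeasurable_funB.
  apply/funext => t; rewrite /= -counting_setD.
  + congr counting; apply/seteqP; split=> x /= [kx].
      by move=> nE; split=> // -[].
    by move=> nE; case: kx => kx _; split=> // Ex; apply: nE.
  + exact: finite_setIl.
  + by move=> x [].
- move=> F _ tF PF; rewrite /P (_ : (fun _ => _) =
    (fun t => \sum_(n <oo)
      (counting (k t `&` [set x | F n (x, t)]) : \bar R))%E).
    apply: ge0_emeasurable_sum => [n t _ _|n _]; last exact: PF.
    by rewrite /counting; case: ifPn; rewrite ?lee_fin ?leey.
  apply/funext => t; rewrite -counting_bigcup.
    congr counting; apply/seteqP; split=> x /=.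
      by move=> [kx [n _ Fx]]; exists n.
    by move=> [n _ [kx Fx]]; split=> //; exists n.
  move=> i j _ _ [x [[_ Fi] [_ Fj]]].
  by apply: (tF i j) => //; exists (x, t).
Qed.

End counting_sections.

(** * Clusters and configurations through the sets that they hit *)

Section counts.
Context {R : realType} {d : nat}.
Local Notation V := 'rV[R]_d.
Implicit Types (X : fcluster R d) (eta : config R d) (B W : set V).

Lemma measurable_config_count B (Y : set (\bar R)) : bounded_borel B ->
  measurable Y -> measurable [set eta : config R d | Y (counting (eta `&` B))].
Proof.
move=> bB mY; apply: sub_sigma_algebra; exists B => //; exists Y => //.
by rewrite setTI.
Qed.

Lemma finite_cluster X : finite_set (cluster_set X).
Proof. exact: finite_fset. Qed.

Lemma setI_neq0P (A B : set V) : A `&` B !=set0 <-> ~ (A `&` B = set0).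
Proof. by split=> [/set0P/eqP//|/eqP/set0P]. Qed.

Definition cluster_voids : set (set (fcluster R d)) :=
  [set [set X | cluster_set X `&` B = set0] | B in @bounded_borel R d].

Lemma cluster_voidsI : setI_closed cluster_voids.
Proof.
move=> _ _ [B bB <-] [C bC <-]; exists (B `|` C); first exact: bounded_borelU.
apply/seteqP; split=> X /=; rewrite setIUr setU_eq0.
  by move=> -[].
by move=> -[].
Qed.

Lemma cluster_voidsT : cluster_voids setT.
Proof.
exists set0; first exact: bounded_borel0.
by apply/seteqP; split=> X //= _; rewrite setI0.
Qed.

(** A cluster has no multiple points, so the numbers of its points in Borel sets
    are determined by the sets that it avoids; and, unlike the events on these
    numbers, the events of avoidance are closed under intersection. *)
Lemma measurable_cluster_voids :
  @measurable _ (fcluster R d) = <<s cluster_voids >>.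
Proof.
apply/seteqP; split; apply: smallest_sub; try exact: smallest_sigma_algebra.
  move=> _ [B bB [Y mY <-]]; rewrite setTI.
  have ms : measurable_hits (fun X : g_sigma_algebraType cluster_voids =>
      cluster_set X `&` B).
    move=> Q oQ bQ; rewrite (_ : [set _ | _] =
        ~` [set X | cluster_set X `&` (B `&` Q) = set0]).
      apply: sigma_algebraC; apply: sub_sigma_algebra; exists (B `&` Q) => //.
      by apply: bounded_borelI => //; exact: bounded_borel_open.
    by apply/seteqP; split=> X /=; rewrite setIA => /setI_neq0P.
  apply: (measurable_counting ms) => X.
  exact/finite_setIl/finite_cluster.
move=> _ [B bB <-]; apply: sub_sigma_algebra; exists B => //.
exists [set 0%E] => //; rewrite setTI.
by apply/seteqP; split=> X /= /counting_eq0.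
Qed.

Lemma measurable_hits_cluster : measurable_hits (@cluster_set R d).
Proof.
move=> B oB bB; rewrite (_ : [set _ | _] =
    ~` [set X : fcluster R d | cluster_set X `&` B = set0]); last first.
  by apply/seteqP; split=> X /= /setI_neq0P.
apply: measurableC; rewrite measurable_cluster_voids.
by apply: sub_sigma_algebra; exists B => //; exact: bounded_borel_open.
Qed.

Lemma measurable_hits_config : measurable_hits (@config_set R d).
Proof.
move=> B oB bB; rewrite (_ : [set _ | _] =
    ~` [set eta : config R d | [set 0%E] (counting (eta `&` B) : \bar R)]).
  apply: measurableC; apply: measurable_config_count => //.
  exact: bounded_borel_open.
by apply/seteqP; split=> eta /=; rewrite counting_eq0 setI_neq0P.
Qed.

Definition subclusters W eta : set (fcluster R d) :=
  [set X | cluster_set X `<=` config_set eta `&` W].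

Lemma subclustersE W eta : bounded_set W ->
  subclusters W eta = [set` fpowerset (fset_set (config_set eta `&` W))].
Proof.
move=> bW; have fW : finite_set (config_set eta `&` W) by exact: config_lf.
apply/seteqP; split=> X /=; rewrite fpowersetE.
  move=> XW; apply/fsubsetP => x xX.
  by rewrite in_fset_set ?inE//; exact: XW.
by move=> /fsubsetP XW x /XW; rewrite in_fset_set ?inE.
Qed.

Lemma finite_subclusters W eta : bounded_set W ->
  finite_set (subclusters W eta).
Proof. by move=> bW; rewrite subclustersE//; exact: finite_fset. Qed.

(** The subclusters of eta in W that avoid B are the subsets of eta in W minus
    B, so that their number is a power of 2. *)
Lemma measurable_subclusters_void W A : bounded_borel W -> cluster_voids A ->
  measurable_fun setT (fun eta => counting (subclusters W eta `&` A) : \bar R).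
Proof.
move=> bW [B bB <-] _ Y mY; rewrite setTI.
have bD := bounded_borelD bW bB.
pose n eta := #|` fset_set (config_set eta `&` (W `\` B))|.
have cE eta : counting (config_set eta `&` (W `\` B)) = (n eta)%:R%:E :> \bar R.
  by rewrite /counting asboolT//; apply: config_lf; exact: bD.2.
have sE eta :
    counting (subclusters W eta `&` [set X | cluster_set X `&` B = set0]) =
    (2 ^ n eta)%:R%:E :> \bar R.
  rewrite (_ : _ `&` _ = subclusters (W `\` B) eta).
    rewrite subclustersE; last exact: bD.2.
    by rewrite /counting asboolT ?set_fsetK ?card_fpowerset.
  apply/seteqP; split=> X /=.
    move=> [XW XB] x Xx; have [ex Wx] := XW x Xx; split=> //; split=> // Bx.
    by have : (cluster_set X `&` B) x by []; rewrite XB.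
  move=> XW; split=> [x /XW[? [? _]]//|].
  by apply/seteqP; split=> x // [/XW[_ []]].
rewrite (_ : _ @^-1` _ = \bigcup_(m in [set m | Y (2 ^ m)%:R%:E])
     [set eta : config R d |
       [set m%:R%:E] (counting (config_set eta `&` (W `\` B)) : \bar R)]).
  by apply: bigcup_measurable => m _; exact: measurable_config_count.
apply/seteqP; split=> eta; rewrite /preimage/= sE.
  by move=> Ye; exists (n eta) => //=; rewrite cE.
by move=> [m Ym]; rewrite /= cE => -[/eqP]; rewrite eqr_nat => /eqP ->.
Qed.

Lemma measurable_subclusters W (E : set (fcluster R d * config R d)) :
  bounded_borel W -> measurable E ->
  measurable_fun setT (fun eta =>
    counting (subclusters W eta `&` [set X | E (X, eta)]) : \bar R).
Proof.
move=> bW; apply: measurable_counting_section.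
- exact: measurable_cluster_voids.
- exact: cluster_voidsI.
- exact: cluster_voidsT.
- by move=> eta; exact: finite_subclusters bW.2.
- by move=> A; exact: measurable_subclusters_void.
Qed.

End counts.

(** * Circumspheres through determinants *)

Section cramer.
Context {R : realType} {d : nat}.
Local Notation V := 'rV[R]_d.
Implicit Types (M : 'M[R]_(d.+1, d)) (c y : V).

(** The edge vectors out of the first vertex; the determinant vanishes exactly
    for degenerate simplices ([affinely_independent_det]). *)
Definition edges M : 'M[R]_d := \matrix_i (row (lift ord0 i) M - row ord0 M).

(** By Cramer's rule, the vector from the first vertex to the circumcenter,
    multiplied by the determinant of the edges ([cramer_centerE]).  This and the
    next quantity are free of divisions, hence continuous at degenerate
    simplices too. *)
Definition cramer_center M : V :=
  (\adj (edges M) *m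
    \col_i (2^-1 * dot (row i (edges M)) (row i (edges M))))^T.

(** The power of y with respect to the circumsphere, multiplied by the square of
    the determinant of the edges ([cramer_powerE]). *)
Definition cramer_power M y : R :=
  \det (edges M) ^+ 2 * dot (y - row ord0 M) (y - row ord0 M)
  - 2 * \det (edges M) * dot (y - row ord0 M) (cramer_center M).

Lemma affinely_independent_det M :
  affinely_independent (fun i => row i M) <-> \det (edges M) != 0.
Proof.
split=> [ai|D0].
  rewrite -unitfE -unitmxE -row_free_unit -kermx_eq0.
  apply/rowV0P => u /sub_kermxP uE.
  pose a (i : 'I_d.+1) : R :=
    oapp (fun j => u ord0 j) (- \sum_j u ord0 j) (unlift ord0 i).
  have aS j : a (lift ord0 j) = u ord0 j by rewrite /a liftK.
  have a0 : a ord0 = - \sum_j u ord0 j by rewrite /a unlift_none.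
  apply/rowP => j; rewrite mxE -aS; apply: ai; rewrite big_ord_recl a0.
    by rewrite addrC -sumrB big1// => k _; rewrite aS subrr.
  rewrite scaleNr scaler_suml addrC -sumrB -[RHS]uE mulmx_sum_row.
  by apply: eq_bigr => k _; rewrite aS rowK scalerBr.
move=> a sa sax; pose u : V := \row_j a (lift ord0 j).
have a0E : a ord0 = - \sum_j a (lift ord0 j).
  by apply/eqP; rewrite -addr_eq0 -[X in _ == X]sa big_ord_recl.
have uE : u *m edges M = 0.
  rewrite -[RHS]sax big_ord_recl a0E scaleNr scaler_suml addrC -sumrB.
  rewrite mulmx_sum_row.
  by apply: eq_bigr => k _; rewrite rowK mxE scalerBr.
have u0 : u = 0.
  have Eu : edges M \in unitmx by rewrite unitmxE unitfE.
  by rewrite -(mulmxK Eu u) uE mul0mx.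
have aS j : a (lift ord0 j) = 0 by have /rowP/(_ j) := u0; rewrite !mxE.
move=> i; case: (unliftP ord0 i) => [j ->|->]; first exact: aS.
by rewrite a0E big1 ?oppr0.
Qed.

(** Expressing that the i-th vertex and the first one are at the same distance
    from c gives the i-th equation of the linear system whose matrix is
    [edges M] and whose unknown is the vector from the first vertex to c. *)
Lemma cramer_centerE M c (s : R) :
  (forall i, dot (row i M - c) (row i M - c) = s) ->
  cramer_center M = \det (edges M) *: (c - row ord0 M).
Proof.
move=> Ms; rewrite /cramer_center; apply: trmx_inj; rewrite trmxK.
rewrite linearZ/= -mul_scalar_mx -mul_adj_mx -mulmxA; congr (_ *m _).
apply/colP => i; rewrite !mxE rowK.
transitivity (dot (row (lift ord0 i) M - row ord0 M) (c - row ord0 M));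
  last first.
  by apply: eq_bigr => j _; rewrite !mxE.
have := Ms (lift ord0 i); rewrite -(Ms ord0) !(dotBl, dotBr).
rewrite (dotC c) (dotC (row ord0 M) (row (lift ord0 i) M)).
rewrite (dotC c (row ord0 M)).
lra.
Qed.

Lemma cramer_radius M c (s : R) :
  (forall i, dot (row i M - c) (row i M - c) = s) ->
  dot (cramer_center M) (cramer_center M) = \det (edges M) ^+ 2 * s.
Proof.
move=> Ms; rewrite (cramer_centerE Ms) dotZl dotC dotZl mulrA -expr2.
by rewrite -(Ms ord0) -opprB dotNl dotC dotNl opprK.
Qed.

Lemma cramer_powerE M c (s : R) y :
  (forall i, dot (row i M - c) (row i M - c) = s) ->
  cramer_power M y = \det (edges M) ^+ 2 * (dot (y - c) (y - c) - s).
Proof.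
move=> Ms; rewrite /cramer_power (cramer_centerE Ms) -(Ms ord0).
rewrite [dot _ (_ *: _)]dotC dotZl !(dotBl, dotBr).
rewrite (dotC c y) (dotC (row ord0 M) y) (dotC c (row ord0 M)).
ring.
Qed.

Section continuity.
Context {T : topologicalType} (M : T -> 'M[R]_(d.+1, d)).
Hypothesis cM : continuous_mx M.

Lemma continuous_mx_row i : continuous_mx (fun t => row i (M t)).
Proof. by move=> k j; under eq_fun do rewrite mxE; exact: cM. Qed.

Lemma continuous_edges : continuous_mx (fun t => edges (M t)).
Proof.
move=> i j; under eq_fun do rewrite !mxE.
by apply: continuous_subr; exact: cM.
Qed.

Lemma continuous_det_edges : continuous (fun t => \det (edges (M t))).
Proof. exact: continuous_det continuous_edges. Qed.

Lemma continuous_cramer_center : continuous_mx (fun t => cramer_center (M t)).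
Proof.
move=> i j; under eq_fun do rewrite mxE.
apply: continuous_mulmx; first exact: continuous_adj continuous_edges.
move=> k l; under eq_fun do rewrite mxE.
apply: continuous_mulr; first exact: cst_continuous.
by apply: continuous_dot => a b; under eq_fun do rewrite mxE;
  exact: continuous_edges.
Qed.

Lemma continuous_cramer_power (y : T -> V) : continuous_mx y ->
  continuous (fun t => cramer_power (M t) (y t)).
Proof.
move=> cy; have c0 := continuous_subrow cy (@continuous_mx_row ord0).
have cD := continuous_det_edges.
apply: continuous_subr; apply: continuous_mulr.
- exact: continuous_mulr.
- exact: continuous_dot.
- by apply: continuous_mulr => //; exact: cst_continuous.
- exact: continuous_dot c0 continuous_cramer_center.
Qed.

End continuity.

Lemma open_det_edges : open [set M : 'M[R]_(d.+1, d) | 0 < \det (edges M) ^+ 2].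
Proof.
have cD := continuous_det_edges (@coord_continuous R d.+1 d).
by apply: open_lt_continuous; [exact: cst_continuous|exact: continuous_mulr].
Qed.

End cramer.

(** * Measurability of the Delaunay property *)

Section delaunay_property.
Context {R : realType} {d : nat}.
Local Notation V := 'rV[R]_d.
Implicit Types (X : fcluster R d) (eta : config R d) (M : 'M[R]_(d.+1, d)).

(** The d + 1 rows are distinct and the cluster has no more than d + 1 points. *)
Lemma simplex_rows X M : \det (edges M) != 0 ->
  (forall i, cluster_set X (row i M)) -> ~ npoints d.+2 X ->
  cluster_set X = range (fun i => row i M).
Proof.
move=> /affinely_independent_det/affinely_independent_inj Mi MX nX.
pose Y : {fset V} := [fset row i M | i : 'I_d.+1]%fset.
have YX : (Y `<=` X)%fset by apply/fsubsetP => _ /imfsetP[i _ ->]; exact: MX.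
have cY : #|` Y| = d.+1 by rewrite card_imfset//= size_enum_ord.
have /eqP XY : X == Y :> {fset V}.
  rewrite eq_sym eqEfcard YX cY leqNgt; apply/negP => /npointsP; exact: nX.
rewrite /cluster_set XY; apply/seteqP; split=> x /=.
  by move=> /imfsetP[i _ ->]; exists i.
by move=> [i _ <-]; apply/imfsetP; exists i.
Qed.

Lemma full_simplexP X : full_simplex X <->
  (exists2 M, 0 < \det (edges M) ^+ 2 & forall i, cluster_set X (row i M)) /\
  ~ npoints d.+2 X.
Proof.
split=> [[x ai XE]|[[M D0 MX] nX]]; last first.
  have {}D0 : \det (edges M) != 0 by move: D0; rewrite exprn_even_gt0.
  exists (fun i => row i M); first exact/affinely_independent_det.
  exact: simplex_rows.
pose M := \matrix_i x i; have rM : (fun i => row i M) = x.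
  by apply/funext => i; rewrite rowK.
split.
  exists M; last by move=> i; rewrite rowK XE; exists i.
  by rewrite exprn_even_gt0//=; apply/affinely_independent_det; rewrite rM.
have {1}-> : cluster_set X = [set` [fset x i | i : 'I_d.+1]%fset].
  rewrite XE; apply/seteqP; split=> y /=.
    by move=> [i _ <-]; apply/imfsetP; exists i.
  by move=> /imfsetP[i _ ->]; exists i.
move/npointsP; rewrite card_imfset//= ?size_enum_ord ?ltnn//.
exact: affinely_independent_inj.
Qed.

Lemma simplex_power X M :
  full_simplex X -> (forall i, cluster_set X (row i M)) -> forall i,
    dot (row i M - circumcenter X) (row i M - circumcenter X) =
    circumradius X ^+ 2.
Proof. by move=> sX MX i; exact: dot_circumcenter. Qed.

Lemma circumradius_gtP X (r : R) : 0 <= r -> full_simplex X ->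
  r < circumradius X <->
  exists2 M, [set M | 0 < \det (edges M) ^+ 2 /\
      \det (edges M) ^+ 2 * r ^+ 2 < dot (cramer_center M) (cramer_center M)] M &
    forall i, cluster_set X (row i M).
Proof.
move=> r0 sX.
rewrite -(ltr_pXn2r (_ : 0 < 2)%N) ?nnegrE ?circumradius_ge0//.
split=> [rX|[M [D0 +] MX]]; last first.
  by rewrite (cramer_radius (simplex_power sX MX)) ltr_pM2l.
have [[M D0 MX] _] := (full_simplexP X).1 sX; exists M => //; split=> //.
by rewrite (cramer_radius (simplex_power sX MX)) ltr_pM2l.
Qed.

(** An open approximation of the following relation: the first row lies in the
    circumball of the other rows and is not one of them.  The positive product
    excludes equality with a vertex, and allowing a power less than 1 / (n + 1)
    makes the condition on the ball open; the closed ball is recovered by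
    letting n tend to infinity. *)
Definition near_ball n (N : 'M[R]_(d.+2, d))
    (M := row' ord0 N) (y := row ord0 N) :=
  [/\ 0 < \det (edges M) ^+ 2, 0 < \prod_i dot (y - row i M) (y - row i M) &
    cramer_power M y < \det (edges M) ^+ 2 * n.+1%:R^-1].

Lemma open_near_ball n : open [set N | near_ball n N].
Proof.
have cM : continuous_mx (fun N : 'M[R]_(d.+2, d) => row' ord0 N).
  by move=> i j; under eq_fun do rewrite mxE; exact: coord_continuous.
have cy : continuous_mx (fun N : 'M[R]_(d.+2, d) => row ord0 N).
  exact: continuous_row.
have cD := continuous_det_edges cM.
have cD2 := continuous_mulr cD cD.
rewrite (_ : [set _ | _] = [set N | 0 < \det (edges (row' ord0 N)) ^+ 2] `&`
   [set N | 0 < \prod_i dot (row ord0 N - row i (row' ord0 N))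
                            (row ord0 N - row i (row' ord0 N))] `&`
   [set N | cramer_power (row' ord0 N) (row ord0 N) <
      \det (edges (row' ord0 N)) ^+ 2 * n.+1%:R^-1]); last first.
  by apply/seteqP; split=> N; [case|case; case].
apply: openI; first apply: openI; apply: open_lt_continuous.
- exact: cst_continuous.
- exact: cD2.
- exact: cst_continuous.
- apply: continuous_prodr => i _.
  apply: continuous_dot; apply: continuous_subrow => //;
    exact: continuous_mx_row.
- exact: continuous_cramer_power.
- exact: continuous_mulr cD2 (@cst_continuous _ _ _).
Qed.

Definition near_points n X eta := exists2 N, [set N | near_ball n N] N &
  forall i, (if i == ord0 then config_set eta else cluster_set X) (row i N).

Lemma near_pointsP n X eta : full_simplex X ->
  near_points n X eta <->
  exists y, [/\ config_set eta y, ~ cluster_set X y &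
    dot (y - circumcenter X) (y - circumcenter X) <
      circumradius X ^+ 2 + n.+1%:R^-1].
Proof.
move=> sX; have [[M0 D0 M0X] nX] := (full_simplexP X).1 sX.
have pwr M y : 0 < \det (edges M) ^+ 2 -> (forall i, cluster_set X (row i M)) ->
    (cramer_power M y < \det (edges M) ^+ 2 * n.+1%:R^-1) =
    (dot (y - circumcenter X) (y - circumcenter X) <
      circumradius X ^+ 2 + n.+1%:R^-1).
  move=> D MX; rewrite (cramer_powerE _ (simplex_power sX MX)) ltr_pM2l//.
  by rewrite ltrBlDl.
split=> [[N [D NX Ny] NE]|[y [ey Xy yc]]].
  have MX i : cluster_set X (row i (row' ord0 N)).
    by have := NE (lift ord0 i); rewrite row_rowsub.
  exists (row ord0 N); split; [exact: (NE ord0)| |]; last first.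
    by rewrite -(pwr (row' ord0 N)).
  have DN : \det (edges (row' ord0 N)) != 0 by move: D; rewrite exprn_even_gt0.
  rewrite (simplex_rows DN MX nX) => -[i _ e].
  have d0 : dot (0 : V) 0 = 0 by apply/eqP; rewrite dot_eq0.
  by move: NX; rewrite (bigD1 i)//= -e subrr d0 mul0r ltxx.
pose N : 'M[R]_(d.+2, d) :=
  \matrix_i oapp (fun j => row j M0) y (unlift ord0 i).
have N0 : row ord0 N = y by rewrite rowK unlift_none.
have NS : row' ord0 N = M0.
  by apply/row_matrixP => i; rewrite row_rowsub rowK liftK.
exists N.
  rewrite /= /near_ball N0 NS; split; rewrite ?pwr//.
  apply: prodr_gt0 => i _; rewrite lt0r dot_ge0 andbT dot_eq0 subr_eq0.
  by apply/eqP => yM; apply: Xy; rewrite yM.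
move=> i; case: (unliftP ord0 i) => [j ->|->]; last by rewrite eqxx N0.
by rewrite rowK liftK; exact: M0X.
Qed.

Lemma finite_uniform_gap (I : choiceType) (S : set I) (f : I -> R) :
  finite_set S -> (forall y, S y -> 0 < f y) ->
  exists n, forall y, S y -> n.+1%:R^-1 < f y.
Proof.
move=> fS f0; have /choice[m hm] : forall y, exists n, S y -> n.+1%:R^-1 < f y.
  move=> y; have [Sy|nSy] := pselect (S y); last by exists 0%N.
  have [n _ /(_ n (leqnn n))/= hn] := near_infty_natSinv_lt (PosNum (f0 y Sy)).
  by exists n.
exists (\max_(y <- fset_set S) m y) => y Sy; apply: le_lt_trans (hm y Sy).
rewrite lef_pV2 ?posrE// ler_nat ltnS.
by apply: leq_bigmax_seq => //; rewrite in_fset_set ?inE.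
Qed.

Lemma bounded_euclidean_ball (c : V) (s : R) :
  bounded_set [set y : V | dot (y - c) (y - c) < s].
Proof.
apply: sub_bounded (bounded_ball c (s + 1)) => y /= ys.
have s0 : 0 < s by exact: le_lt_trans (dot_ge0 _) ys.
split=> [|i j]; first by rewrite addr_gt0.
rewrite ord1 /ball/= distrC (le_lt_trans (ler_edist_coord _ _ _))//.
rewrite ltNge; apply/negP => h.
by have := sqr_edist y c; nra.
Qed.

(** Only finitely many points of eta are close to the circumball, so that the
    points outside the ball keep a positive distance from it: as soon as
    eta contains points with power less than 1 / (n + 1) for all n, it
    contains one in the ball. *)
Lemma empty_circumballP X eta : full_simplex X ->
  (circumball X `\` X) `&` eta = set0 <-> exists n, ~ near_points n X eta.
Proof.
move=> sX; pose f (y : V) :=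
  dot (y - circumcenter X) (y - circumcenter X) - circumradius X ^+ 2.
have ballE y : circumball X y <-> f y <= 0.
  by rewrite subr_le0 -edist_le// circumradius_ge0.
split; last first.
  move=> [n nX]; apply/seteqP; split=> // y [[Ky Xy] ey].
  apply: nX; apply/near_pointsP => //.
  exists y; split=> //; apply: le_lt_trans (_ : circumradius X ^+ 2 < _).
    by rewrite -subr_le0; exact/ballE.
  by rewrite ltrDl invr_gt0.
move=> K0; pose K1 : set V := [set y |
  dot (y - circumcenter X) (y - circumcenter X) < circumradius X ^+ 2 + 1].
pose S := (config_set eta `&` K1) `\` cluster_set X.
have [||n hn] := @finite_uniform_gap _ S f.
- exact/finite_setD/config_lf/bounded_euclidean_ball.
- move=> y [[ey _] Xy]; rewrite ltNge; apply/negP => /ballE Ky.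
  by have /seteqP[/(_ y) + _] := K0; apply.
exists n => /near_pointsP -/(_ sX)[y [ey Xy yn]].
have n1 : n.+1%:R^-1 <= 1 :> R by rewrite invf_le1 ?ler1n.
have : S y by split=> //; split=> //=; apply: lt_le_trans yn _; rewrite lerD2l.
by move=> /hn; rewrite /f ltrBrDl; move/(lt_trans yn); rewrite ltxx.
Qed.

(** Full simplices are the clusters that contain d + 1 affinely independent
    points but not d + 2 points.  A circumradius larger than r is an open
    relation, so its bound is the complement of one, and emptiness of the
    circumball is a countable union of complements of open relations. *)
Lemma measurable_DR (r : R) : 0 <= r ->
  measurable (DR r : set (fcluster R d * config R d)).
Proof.
move=> r0; pose T := (fcluster R d * config R d)%type.
have hX : measurable_hits (fun p : T => cluster_set p.1).
  move=> B oB bB; rewrite -[X in measurable X]setIT.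
  exact: (measurableX (measurable_hits_cluster oB bB) measurableT).
have he : measurable_hits (fun p : T => config_set p.2).
  move=> B oB bB; rewrite -[X in measurable X]setTI.
  exact: (measurableX measurableT (measurable_hits_config oB bB)).
pose simplex := [set p : T | exists2 M, [set M | 0 < \det (edges M) ^+ 2] M &
  forall i, cluster_set p.1 (row i M)].
pose big := [set p : T | npoints d.+2 (cluster_set p.1)].
pose large := [set p : T | exists2 M, [set M | 0 < \det (edges M) ^+ 2 /\
      \det (edges M) ^+ 2 * r ^+ 2 < dot (cramer_center M) (cramer_center M)] M &
    forall i, cluster_set p.1 (row i M)].
pose near n := [set p : T | near_points n p.1 p.2].
have -> : DR r = (simplex `\` big `\` large) `&` \bigcup_n ~` near n.
  apply/seteqP; split=> -[X eta] /=.
    move=> [sX /(empty_circumballP _ sX)[n nX] rX]; split; last by exists n.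
    have /full_simplexP[? ?] := sX; split; first by split.
    by move/(circumradius_gtP r0 sX); rewrite ltNge rX.
  move=> [[[sX nX] lX] [n _ nn]].
  have fX : full_simplex X by apply/full_simplexP.
  split=> //; first by apply/empty_circumballP => //; exists n.
  by rewrite leNgt; apply/negP => /(circumradius_gtP r0 fX).
have cM := @coord_continuous R d.+1 d.
have cD := continuous_det_edges cM; have cC := continuous_cramer_center cM.
apply: measurableI; first apply: measurableD; first apply: measurableD.
- exact: (measurable_tuple_hits (open_det_edges) (fun=> hX)).
- exact: measurable_npoints.
- apply: (measurable_tuple_hits _ (fun=> hX)); apply: openI.
    exact: open_det_edges.
  apply: open_lt_continuous; last exact: continuous_dot.
  exact: continuous_mulr (continuous_mulr cD cD) (@cst_continuous _ _ _).
- apply: bigcup_measurable => n _; apply: measurableC.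
  pose s (i : 'I_d.+2) (p : T) : set V :=
    if i == ord0 then config_set p.2 else cluster_set p.1.
  have hs i : measurable_hits (s i) by rewrite /s; case: (i == ord0).
  exact: (measurable_tuple_hits (@open_near_ball n) hs).
Qed.

End delaunay_property.

(** * The image process *)

Section image.
Context {R : realType} {d : nat}.
Local Notation V := 'rV[R]_d.
Implicit Types (mu : cconfig R d) (eta : config R d) (X : fcluster R d).

Definition window m : set V := ball 0 m.+1%:R.

Lemma bounded_borel_window m : bounded_borel (window m).
Proof.
by apply: bounded_borel_open; [exact: ball_open|exact: bounded_ball].
Qed.

Lemma cluster_window X : exists m, cluster_set X `<=` window m.
Proof.
have g0 (x : V) : cluster_set X x -> 0 < (1 + `|x|)^-1.
  by rewrite invr_gt0 ltr_wpDr.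
have [m hm] := finite_uniform_gap (finite_cluster X) g0.
exists m => x /hm; rewrite ltf_pV2 ?posrE ?ltr_wpDr// => xm.
by rewrite /window -ball_normE/= sub0r normrN (lt_trans _ xm)// ltrDr.
Qed.

(** The clusters of [phi_DR r eta] in A are the increasing union of those
    inside the windows, which are finite in number. *)
Lemma measurable_phi_DR (r : R) : 0 <= r ->
  measurable_fun setT (phi_DR r : config R d -> cconfig R d).
Proof.
move=> r0; apply: (measurability (@cconfig_generators R d)) => //.
move=> _ [_ [A mA [Y mY <-]] <-]; rewrite !setTI.
pose E := (A `*` setT) `&` (DR r : set (fcluster R d * config R d)).
have mE : measurable E.
  by apply: measurableI; [exact: measurableX|exact: measurable_DR].
suff : measurable_fun setT (fun eta : config R d =>
    counting (clusters_of_type (DR r) eta `&` A) : \bar R).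
  by move=> /(_ measurableT Y mY); rewrite setTI.
pose F m eta := subclusters (window m) eta `&` [set X | E (X, eta)].
apply: (emeasurable_fun_cvg (fun m eta => counting (F m eta) : \bar R))
  => [m|eta _].
  exact: (measurable_subclusters (bounded_borel_window m) mE).
rewrite (_ : _ `&` _ = \bigcup_m F m eta).
  apply: counting_cvg => m n mn; apply/subsetPset => X [XW EX].
  split=> // x /XW[ex Wx]; split=> //.
  by apply: le_ball Wx; rewrite ler_nat.
apply/seteqP; split=> X /=.
  move=> [[Xeta DX] AX]; have [m Xm] := cluster_window X.
  by exists m => //; split=> // x Xx; split; [exact: Xeta|exact: Xm].
by move=> [m _ [XW [[AX _] DX]]]; split=> //; split=> // x /XW[].
Qed.

Lemma measurable_cconfig_count (A : set (fcluster R d)) : measurable A ->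
  measurable_fun setT (fun mu : cconfig R d => counting (mu `&` A) : \bar R).
Proof.
move=> mA _ Y mY; rewrite setTI; apply: sub_sigma_algebra; exists A => //.
by exists Y => //; rewrite setTI.
Qed.

Lemma locally_finite_cover mu :
  locally_finite (\bigcup_(X in cconfig_set mu) cluster_set X).
Proof.
move=> B bB; apply: sub_finite_set (bigcup_finite (cconfig_lf mu bB)
  (fun X _ => finite_cluster X)).
by move=> x [[X muX Xx] Bx]; exists X => //; split=> //; exists x.
Qed.

Definition cover mu : config R d := Config (@locally_finite_cover mu).

Lemma cover_hits mu B :
  config_set (cover mu) `&` B !=set0 <->
  cconfig_set mu `&` [set X | cluster_set X `&` B !=set0] !=set0.
Proof.
split=> [[x [[X muX Xx] Bx]]|[X [muX [x [Xx Bx]]]]].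
  by exists X; split=> //; exists x.
by exists x; split=> //; exists X.
Qed.

Lemma measurable_cover : measurable_fun setT cover.
Proof.
apply: (measurability (@config_generators R d)) => //.
move=> _ [_ [B bB [Y mY <-]] <-]; rewrite !setTI.
have ms : measurable_hits (fun mu => config_set (cover mu) `&` B).
  move=> Q oQ bQ; have bBQ := bounded_borelI bB (bounded_borel_open oQ bQ).
  rewrite (_ : [set _ | _] = ~` ((fun mu : cconfig R d => counting
      (mu `&` [set X | cluster_set X `&` (B `&` Q) !=set0]) : \bar R)
      @^-1` [set 0%E])).
    apply: measurableC; rewrite -[_ @^-1` _]setTI.
    apply: measurable_cconfig_count => //.
    rewrite (_ : [set _ | _] = ~` [set X | cluster_set X `&` (B `&` Q) = set0]).
      apply: measurableC; rewrite measurable_cluster_voids.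
      by apply: sub_sigma_algebra; exists (B `&` Q).
    by apply/seteqP; split=> X /= /setI_neq0P.
  apply/seteqP; split=> mu; rewrite /= /preimage/= -setIA counting_eq0 => h.
    by apply/eqP/set0P/cover_hits.
  by apply/cover_hits/set0P/eqP.
apply: (measurable_counting ms) => mu.
exact/(config_lf (cover mu))/bB.2.
Qed.

(** A measurable substitute for the set of tessellations: the Delaunay property
    is tested against the points of the clusters themselves, as the
    configuration they come from cannot be recovered from them. *)
Definition self_delaunay (r : R) : set (cconfig R d) :=
  [set mu | cconfig_set mu `<=` clusters_of_type (DR r) (cover mu)].

(** All vertices of the image belong to eta, and removing points from eta leaves
    the circumballs empty. *)
Lemma self_delaunay_phi_DR r eta : self_delaunay r (phi_DR r eta).
Proof.
move=> X pX; split=> [x Xx|]; first by exists X.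
have [Xeta [sX K0 Xr]] := pX; split=> //.
apply/seteqP; split=> // x [Kx [Z [Zeta _] Zx]].
by move/seteqP : K0 => [/(_ x) + _]; apply; split=> //; exact: Zeta.
Qed.

(** The number of clusters which meet a window and are not Delaunay in the cover
    is a measurable function, because such clusters are finite in number and the
    cover is a measurable function of the configuration; it has to vanish for
    all windows.  The empty cluster meets no window and is excluded apart. *)
Lemma measurable_self_delaunay r : 0 <= r -> measurable (self_delaunay r).
Proof.
move=> r0.
pose E := [set p : fcluster R d * cconfig R d | ~ DR r (p.1, cover p.2)].
have mE : measurable E.
  rewrite (_ : E = ~` ((fun p => (p.1, cover p.2)) @^-1` DR r))//.
  apply: measurableC; rewrite -[_ @^-1` _]setTI.
  apply: measurable_fun_pair => //; last exact: measurable_DR.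
  by apply: measurableT_comp => //; exact: measurable_cover.
pose hit m : set (fcluster R d) := [set X | cluster_set X `&` window m !=set0].
have mhit m : measurable (hit m).
  exact: measurable_hits_cluster (ball_open _ _) (bounded_ball _ _).
pose empty : set (fcluster R d) := ~` \bigcup_m hit m.
have mempty : measurable empty by apply/measurableC/bigcupT_measurable.
pose bad m (mu : cconfig R d) := (mu `&` hit m) `&` [set X | E (X, mu)].
have mbad m : measurable_fun setT (fun mu => counting (bad m mu) : \bar R).
  apply: (@measurable_counting_section _ _ _ _ _ measurable) => //.
  - by rewrite sigma_algebra_id//; exact: sigma_algebra_measurable.
  - exact: measurableI.
  - by move=> mu; apply: cconfig_lf; exact: bounded_ball.
  - move=> A mA; under eq_fun do rewrite -setIA.
    by apply: measurable_cconfig_count; exact: measurableI.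
have null (f : cconfig R d -> \bar R) : measurable_fun setT f ->
    measurable [set mu | f mu = 0%E].
  by move=> mf; have := mf measurableT [set 0%E] ltac:(by []); rewrite setTI.
rewrite (_ : self_delaunay r =
  (\bigcap_m [set mu | counting (bad m mu) = 0%E :> \bar R]) `&`
  [set mu : cconfig R d | counting (mu `&` empty) = 0%E :> \bar R]).
  apply: measurableI; last first.
    by apply: null; exact: measurable_cconfig_count.
  by apply: bigcapT_measurable => m; exact: null.
apply/seteqP; split=> mu.
  move=> muD; split=> [m _|]; apply/counting_eq0/seteqP; split=> X //.
    by move=> [[/muD[_ DX] _]]; apply.
  (* A simplex has a vertex, hence it meets some window. *)
  move=> [/muD[_ [[x _ XE] _ _]] nX]; apply: nX.
  have [m Xm] := cluster_window X; exists m => //; exists (x ord0).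
  have Xx : cluster_set X (x ord0) by rewrite XE; exists ord0.
  by split=> //; exact: Xm.
move=> [nbad /counting_eq0 nempty] X muX; split=> [x Xx|]; first by exists X.
have [m _ hX] : (\bigcup_m hit m) X.
  apply: contrapT => nX; have /seteqP[/(_ X) + _] := nempty; apply.
  by split.
apply: contrapT => nD; have /counting_eq0/seteqP[/(_ X) + _] := nbad m I.
by apply.
Qed.

End image.

Unset Implicit Arguments.

Theorem proposition1 (R : realType) (d : nat) (r : R)
    (d_ge1 : (1 <= d)%N) (r_gt0 : 0 < r) (P : probability (config R d) R) :
  exists2 phi : {mfun config R d >-> cconfig R d},
    (forall eta : config R d, phi eta = phi_DR r eta) &
    random_cluster_tessellation (distribution P phi).
Proof.
have mphi : phi_DR r \in (mfun : {pred config R d -> cconfig R d}).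
  by rewrite inE; exact: measurable_phi_DR (ltW r_gt0).
exists (mfun_Sub mphi) => //.
exists (~` self_delaunay r); split.
- exact: measurableC (measurable_self_delaunay (ltW r_gt0)).
- rewrite -[RHS](measure0 P); congr (P _).
  by apply/seteqP; split=> // eta; apply; exact: self_delaunay_phi_DR.
- move=> mu ntess selfmu; apply: ntess.
  exact: delaunay_tessellation d_ge1 selfmu.
Qed.
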